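(* Let $G$ be a countable discrete group and let $H$ be a subgroup of $G$. If $G$ has property A, then $H$ has property A.
   Context: Property A: a discrete metric space $(X,d)$ has property A if for all $R,\epsilon>0$ there exists a family $\{A_x\}_{x\in X}$ of finite, non-empty subsets of $X\times\mathbb{N}$ such that (i) for all $x,y\in X$ with $d(x,y)\le R$ we have $\frac{|A_x\triangle A_y|}{|A_x\cap A_y|}<\epsilon$; (ii) there exists $S$ such that for each $x\in X$, if $(y,n)\in A_x$ then $d(x,y)\le S$. Groups as metric spaces: a discrete metric space $X$ has bounded geometry if for all $r>0$ there is $N_r$ with $|B(x,r)|<N_r$ for all $x\in X$. Every countable discrete group $G$ admits a left-invariant metric ($d(hg,hg')=d(g,g')$) of bounded geometry, and any two such metrics are coarsely equivalent via the identity map. A countable discrete group is said to have property A if it has property A as a metric space with respect to some (equivalently, every) left-invariant bounded geometry metric. *)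

(* Defs.v *)
From HB Require Import structures.
From mathcomp Require Import all_boot all_order all_algebra.
From mathcomp Require Import finmap.
From mathcomp Require Import boolp classical_sets functions cardinality reals.

Set Implicit Arguments.
Unset Strict Implicit.
Unset Printing Implicit Defensive.

Local Open Scope classical_set_scope.
Local Open Scope ring_scope.

(* Metrics are unbundled functions rather than metricType structures because
   property A of a group quantifies over the metrics carried by that group. *)
Record is_metric (R : realType) (X : Type) (d : X -> X -> R) : Prop := {
  metric_ge0 : forall x y, 0 <= d x y ;
  metric_eq0 : forall x y, d x y = 0 <-> x = y ;
  metric_sym : forall x y, d x y = d y x ;
  metric_triangle : forall x y z, d x z <= d x y + d y z }.

(* The metric topology is discrete: every point is isolated. *)
Definition discrete_metric (R : realType) (X : Type) (d : X -> X -> R) : Prop :=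
  is_metric d /\
  forall x, exists2 r : R, 0 < r & forall y, d x y < r -> y = x.

Definition metric_ball (R : realType) (X : Type) (d : X -> X -> R)
    (x : X) (r : R) : set X := [set y | d x y < r].

(* fset_set sends infinite sets to the empty fset, hence the separate
   finiteness requirement. *)
Definition bounded_geometry (R : realType) (X : choiceType)
    (d : X -> X -> R) : Prop :=
  forall r : R, 0 < r -> exists N : nat, forall x : X,
    finite_set (metric_ball d x r) /\
    (#|` fset_set (metric_ball d x r)| < N)%N.

Definition symdiff (T : choiceType) (A B : {fset T}) : {fset T} :=
  ((A `\` B) `|` (B `\` A))%fset.

(* Since x / 0 = 0, the quotient being well defined has to be
   stated as the nonemptiness of the intersection. *)
Definition property_A (R : realType) (X : choiceType) (d : X -> X -> R) : Prop :=
  forall r eps : R, 0 < r -> 0 < eps ->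
  exists A : X -> {fset (X * nat)},
    [/\ forall x, A x != fset0,
        forall x y, d x y <= r ->
          (A x `&` A y)%fset != fset0 /\
          #|` symdiff (A x) (A y)|%:R / #|` (A x `&` A y)%fset|%:R < eps
      & exists S : R, forall x y (n : nat), (y, n) \in A x -> d x y <= S].

Definition left_invariant (R : realType) (G : groupType)
    (d : G -> G -> R) : Prop :=
  forall h g g' : G, d (h * g)%g (h * g')%g = d g g'.

(* G is meant to be countable and discrete as a topological group, so no
   topology on G is involved. *)
Definition group_property_A (R : realType) (G : groupType) : Prop :=
  exists d : G -> G -> R,
    [/\ discrete_metric d, left_invariant d, bounded_geometry d
      & property_A d].

(* Main.v *)
Require Import Defs.
From HB Require Import structures.
From mathcomp Require Import all_boot all_order all_algebra.
From mathcomp Require Import finmap.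
From mathcomp Require Import boolp classical_sets functions cardinality reals.

(** A left-invariant metric of bounded geometry on G restricts to one on H, so
    it suffices that property A passes to subspaces of a countable metric space
    X.  If the sets A_y, for y in Y, are supported in S-balls, push them forward
    along (x, n) |-> (p x, code (x, n)), where p x is a point of Y within
    distance S of x and code : X * nat -> nat is injective.  This map is
    injective, so it preserves all cardinalities, and the new supports lie in
    balls of radius 2S. *)

Import Order.TTheory GRing.Theory Num.Theory.
Local Open Scope ring_scope.

Section FsetImage.
Variables (T U : choiceType) (f : T -> U).
Hypothesis f_inj : injective f.

Lemma card_imfset_inj (A : {fset T}) : #|` (f @` A)%fset| = #|` A|.
Proof. exact: card_imfset. Qed.

Lemma imfsetI_inj (A B : {fset T}) :
  (f @` A `&` f @` B)%fset = (f @` (A `&` B))%fset.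
Proof. by rewrite imfsetI // => x y _ _; apply: f_inj. Qed.

Lemma imfsetD_inj (A B : {fset T}) :
  (f @` A `\` f @` B)%fset = (f @` (A `\` B))%fset.
Proof.
apply/fsetP => u; apply/fsetDP/imfsetP => /= [[/imfsetP[x /= xA ->] fxB]|].
  exists x => //; rewrite inE xA andbT.
  by apply: contra fxB => xB; apply: in_imfset.
move=> [x /fsetDP[xA xB] ->]; split; first exact: in_imfset.
by rewrite mem_imfset.
Qed.

Lemma symdiff_imfset (A B : {fset T}) :
  symdiff (f @` A)%fset (f @` B)%fset = (f @` symdiff A B)%fset.
Proof. by rewrite /symdiff !imfsetD_inj imfsetU. Qed.

Lemma imfset_neq0 (A : {fset T}) : A != fset0 -> (f @` A)%fset != fset0.
Proof.
by case/fset0Pn => x xA; apply/fset0Pn; exists (f x); apply: in_imfset.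
Qed.

End FsetImage.

Section Restriction.
Variables (R : realType) (X Y : choiceType) (f : Y -> X) (d : X -> X -> R).

Let dY (y y' : Y) := d (f y) (f y').

Lemma discrete_metric_restrict :
  injective f -> discrete_metric d -> discrete_metric dY.
Proof.
move=> f_inj [[d_ge0 d_eq0 d_sym d_tri] d_disc]; split.
  split=> [y y'|y y'|y y'|y y' y'']; rewrite /dY //.
  by split=> [/d_eq0/f_inj|->] //; apply/d_eq0.
move=> y; have [r r_gt0 ball_r] := d_disc (f y).
by exists r => // y' /ball_r/f_inj.
Qed.

(** [f] embeds each [dY]-ball into the [d]-ball of the same radius about the image of its centre, so
    the same [N] works. *)
Lemma bounded_geometry_restrict :
  injective f -> bounded_geometry d -> bounded_geometry dY.
Proof.
move=> f_inj d_bg r r_gt0; have [N ballN] := d_bg r r_gt0.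
exists N => y; have [ball_fin ball_card] := ballN (f y).
have fin : finite_set (metric_ball dY y r).
  by apply: (finite_preimage _ ball_fin) => u v _ _; apply: f_inj.
split=> //; apply: leq_ltn_trans ball_card.
rewrite -(card_imfset_inj _ _ _ f_inj); apply: fsubset_leq_card.
apply/fsubsetP => _ /imfsetP[z /= + ->].
by rewrite !in_fset_set // !inE.
Qed.

Lemma property_A_restrict (y0 : Y) : countable [set: X]%classic ->
  is_metric d -> property_A d -> property_A dY.
Proof.
move=> /countable_injP[c c_inj] [_ _ d_sym d_tri] d_A r eps r_gt0 eps_gt0.
have [A [A_neq0 A_close [S A_supp]]] := d_A r eps r_gt0 eps_gt0.
(* The bound is conditional so that [p] is total: an [x] with no point of [Y] within [S] is sent to
   [y0]. *)
have [p p_near] : exists p : X -> Y,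
    forall x y, d (f y) x <= S -> d (f (p x)) x <= S.
  suff /choice[p pP] : forall x, exists z, forall y,
    d (f y) x <= S -> d (f z) x <= S by exists p.
  move=> x; have [[z zx]|no_near] := pselect (exists z, d (f z) x <= S).
    by exists z.
  by exists y0 => y yx; case: no_near; exists y.
(* [p] may identify points, so the second coordinate alone must recover both [x] and [n];
   countability of [X] enters through [c]. *)
pose phi (u : X * nat) := (p u.1, choice.pickle (c u.1, u.2)).
have phi_inj : injective phi.
  move=> [x n] [x' n'] [_ /(pcan_inj choice.pickleK)[cx ->]].
  by rewrite (c_inj _ _ _ _ cx) ?inE.
exists (fun y => phi @` A (f y))%fset; split=> [y|y y' yy'|].
- exact: imfset_neq0.
- have [I_neq0 ratio_lt] := A_close _ _ yy'.
  rewrite symdiff_imfset // imfsetI_inj // !card_imfset_inj //.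
  by split=> //; apply: imfset_neq0.
(* Go from [f y] to [f (p x)] through [x]: each leg is at most [S]. *)
exists (S + S) => y _ _ /imfsetP[[x n] /= /A_supp yx [-> _]].
apply: le_trans (d_tri _ x _) _; apply: lerD => //.
by rewrite d_sym; apply: p_near yx.
Qed.

End Restriction.

Theorem lemma2p3p4 (R : realType) (G : groupType)
    (countG : countable [set: G]%classic)
    (S : pred G) (H : subGroupType S) :
  group_property_A R G -> group_property_A R H.
Proof.
move=> [d [d_disc d_inv d_bg d_A]].
exists (fun h h' : H => d (val h) (val h')); split.
- exact: discrete_metric_restrict val_inj d_disc.
(* [val] is a group morphism, so this is left invariance in [G]. *)
- by move=> h g g'; rewrite !gmulfM d_inv.
- exact: bounded_geometry_restrict val_inj d_bg.
(* The identity of [H] serves as the default point [y0]. *)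
- by apply: property_A_restrict => //; [exact: 1%g | case: d_disc].
Qed.
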